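(* Let $c\ge 0$ and let $F:[1,\infty)\to[0,\infty)$ be an increasing function. Investor has a strategy ensuring $$\mathcal K_t\ge cX_t+F(X_t^* )\quad\text{for all } t$$ if and only if $c$ and $F$ satisfy $$\int_1^\infty\frac{F(y)}{y^2}\,dy\le 1-c.$$
   Context: ''Increasing'' is meant in the non-strict sense. Trading game (discrete time, perfect information): $X_0:=1$, $\mathcal K_0:=1$; for $t=1,2,\dots$: Investor announces $p_t\in\mathbb R$, then Market announces $X_t\in[0,\infty)$, and $\mathcal K_t:=\mathcal K_{t-1}+p_t(X_t-X_{t-1})$. Put $X_t^*:=\max_{s\le t}X_s$. A strategy for Investor is a function $\Pi$ from the set of all finite sequences of Market's moves (including the empty one) to $\mathbb R$, prescribing $p_t=\Pi(X_1,\dots,X_{t-1})$. A strategy ensures a property if the property holds for every infinite sequence $X_1,X_2,\dots\in[0,\infty)$ of Market's moves. *)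

(* Defs.v *)
From HB Require Import structures.
From mathcomp Require Import all_boot all_order all_algebra.
From mathcomp Require Import all_classical all_reals all_analysis.

Set Implicit Arguments.
Unset Strict Implicit.
Unset Printing Implicit Defensive.

Import Order.TTheory GRing.Theory Num.Theory.
Import numFieldNormedType.Exports.

Local Open Scope ring_scope.

Section TradingGame.
Context {R : realType}.

(* Market's play is a sequence [x : nat -> R] whose term [x s] is the move made
   in round [s.+1]; the initial price X_0 = 1 is not a move. *)
Definition price (x : nat -> R) (t : nat) : R :=
  if t is s.+1 then x s else 1.

Definition running_max (x : nat -> R) (t : nat) : R :=
  \big[Num.max/price x 0]_(s < t.+1) price x s.

(* Investor's strategy sees Market's past moves, oldest first and without X_0.
   Its values on sequences with a negative entry never matter, since Market's
   moves are required to be nonnegative in [ensures]. *)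
Definition strategy : Type := seq R -> R.

(* [mkseq x s] is the history X_1, ..., X_s available in round [s.+1]. *)
Fixpoint capital (Pi : strategy) (x : nat -> R) (t : nat) : R :=
  if t is s.+1
  then capital Pi x s + Pi (mkseq x s) * (price x s.+1 - price x s)
  else 1.

Definition ensures (Pi : strategy)
    (property : strategy -> (nat -> R) -> Prop) : Prop :=
  forall x : nat -> R, (forall s, 0 <= x s) -> property Pi x.

End TradingGame.

Arguments strategy R : clear implicits.

(* Main.v *)
(* Sufficiency: with [I m] the integral of [F y / y ^+ 2] over [m, +oo[, betting
   [c + h M] at running maximum [M], where [h m = I m - F m / m], maintains
   [K >= c X + h M * X + F M]. Here [h m] is the Stieltjes integral of
   [dF y / y] over [m, +oo[: a static portfolio of [dF y / y] units of the
   asset, each sold when the price reaches [y].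
   Necessity: Market follows a geometric grid upwards and threatens to crash to
   0 at every step, which bounds the lower Riemann sums of the integral. *)
Require Import Defs.
From HB Require Import structures.
From mathcomp Require Import all_boot all_order all_algebra.
From mathcomp Require Import all_classical all_reals all_analysis.
From mathcomp Require Import measurable_realfun ring lra.

Set Implicit Arguments.
Unset Strict Implicit.
Unset Printing Implicit Defensive.

Import Order.TTheory GRing.Theory Num.Theory.
Import numFieldNormedType.Exports.

Local Open Scope ring_scope.

(** * The game: lower sums from a strategy, and a strategy from tail bounds *)

Section Game.
Context {R : realType}.

(** Needed to compare a rising path with its copy that crashes later: up to the crash both yield the
    same capital. *)
Lemma capital_eq (Pi : strategy R) (x y : nat -> R) (t : nat) :
  (forall s, (s < t)%N -> x s = y s) -> capital Pi x t = capital Pi y t.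
Proof.
elim: t => //= t IH xy.
have -> : mkseq x t = mkseq y t.
  apply: (@eq_from_nth _ 0); rewrite !size_mkseq// => i it.
  by rewrite !nth_mkseq// xy// ltnS ltnW.
rewrite IH; last by move=> s st; rewrite xy// ltnS ltnW.
case: t xy {IH} => [|t] xy /=; first by rewrite xy.
by rewrite xy// xy.
Qed.

Lemma price_le_running_max (x : nat -> R) (s t : nat) :
  (s <= t)%N -> price x s <= running_max x t.
Proof.
rewrite -ltnS => st; rewrite /running_max.
exact: (@le_bigmax _ _ _ _ (fun i : 'I_t.+1 => price x i) (Ordinal st)).
Qed.

Lemma running_max_ge1 (x : nat -> R) (t : nat) : 1 <= running_max x t.
Proof. exact: (@price_le_running_max x 0). Qed.

(** A strategy sees only the list of moves, which omits X_0 = 1; the seed 1 of the fold restores it,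
    so Investor can compute the running maximum. *)
Lemma running_maxE (x : nat -> R) (t : nat) :
  running_max x t = foldl Num.max 1 (mkseq x t).
Proof.
elim: t => [|t IH].
  by rewrite /running_max big_ord_recl big_ord0 /= maxxx.
rewrite mkseqS foldl_rcons -IH; apply/le_anti/andP; split.
  apply: bigmax_le => [|[s /= st] _].
    by rewrite le_max running_max_ge1.
  rewrite le_max; case: (ltnP s t.+1) => [{}st|ts].
    by rewrite price_le_running_max.
  have -> : s = t.+1 by apply/eqP; rewrite eqn_leq ts andbT -ltnS.
  by rewrite lexx orbT.
rewrite ge_max (@price_le_running_max x t.+1 t.+1)// andbT.
apply: bigmax_le => [|s _]; first exact: running_max_ge1.
by apply: price_le_running_max; rewrite ltnW.
Qed.

(* Along the path 1 = b 0, b 1, ... the game can crash to 0 just after [b n];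
   surviving this forces [p <= (K_n - F (b n)) / b n] for the next bet [p]. *)
Lemma ensures_lower_sum_le (c : R) (F : R -> R) (Pi : strategy R)
    (b : nat -> R) :
  (forall y, 1 <= y -> 0 <= F y) ->
  (forall y z, 1 <= y -> y <= z -> F y <= F z) ->
  ensures Pi (fun Pi x =>
    forall t, c * price x t + F (running_max x t) <= capital Pi x t) ->
  b 0 = 1 -> nondecreasing_seq b ->
  forall n, \sum_(i < n) F (b i) * ((b i)^-1 - (b i.+1)^-1) <= 1 - c.
Proof.
move=> F_ge0 F_incr Pi_ok b0 b_nd n.
have b_ge1 i : 1 <= b i by rewrite -b0 b_nd.
have b_gt0 i : 0 < b i by rewrite (lt_le_trans _ (b_ge1 i)).
pose x s := b s.+1.
have priceE i : price x i = b i by case: i.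
pose V i := capital Pi x i.
(* With the asset as numeraire, [V i / b i] is the capital in units of the asset; each step up loses
   at least one term of the lower sum. *)
have step i : V i.+1 / b i.+1 <=
    V i / b i - F (b i) * ((b i)^-1 - (b i.+1)^-1).
  set p := Pi (mkseq x i).
  have Vi : V i.+1 = V i + p * (b i.+1 - b i) by rewrite /V /= -/p priceE.
  have p_le : p * b i <= V i - F (b i).
    (* The kept moves are [b 1], ..., [b i], so the crash falls in round [i.+1], exactly where the
       bet [p] is at stake. *)
    pose y s := if (s < i)%N then x s else 0.
    have yx s : (s < i)%N -> y s = x s by rewrite /y => ->.
    have y_ge0 s : 0 <= y s by rewrite /y; case: ifP => // _; exact/ltW/b_gt0.
    have := Pi_ok y y_ge0 i.+1.
    have -> : capital Pi y i.+1 = V i - p * b i.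
      rewrite /= (capital_eq _ yx) -/(V i) {2}/y ltnn.
      have -> : mkseq y i = mkseq x i.
        apply: (@eq_from_nth _ 0); rewrite !size_mkseq// => j ji.
        by rewrite !nth_mkseq// yx.
      have -> : price y i = b i.
        by case: (i) yx => //= j ->.
      by rewrite sub0r mulrN.
    have -> : price y i.+1 = 0 by rewrite /= /y ltnn.
    rewrite mulr0 add0r => leV.
    rewrite lerBrDr addrC -lerBrDr; apply: le_trans leV.
    apply: F_incr => //; have -> : b i = price y i.
      by case: (i) yx => //= j ->.
    exact: price_le_running_max.
  have le1 : 0 <= (b i.+1 - b i) / (b i * b i.+1).
    by rewrite divr_ge0 ?subr_ge0 ?b_nd// mulr_ge0// ltW.
  rewrite -subr_ge0 Vi.
  have -> : V i / b i - F (b i) * ((b i)^-1 - (b i.+1)^-1) -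
      (V i + p * (b i.+1 - b i)) / b i.+1 =
      (V i - F (b i) - p * b i) * ((b i.+1 - b i) / (b i * b i.+1)).
    by field; rewrite !gt_eqF.
  by rewrite mulr_ge0// subr_ge0.
have sum_le : \sum_(i < n) F (b i) * ((b i)^-1 - (b i.+1)^-1) <=
    1 - V n / b n.
  elim: n => [|m IH]; first by rewrite big_ord0 b0 /V /= divr1 subrr.
  rewrite big_ord_recr /=; have := step m; lra.
(* What telescoping leaves over is at least [c]: the ensured bound gives [V n >= c * b n], as [F] is
   nonnegative. *)
apply: (le_trans sum_le); rewrite lerD2l lerN2 ler_pdivlMr//.
have /(_ n) := Pi_ok x (fun s => ltW (b_gt0 s.+1)).
rewrite priceE; apply: le_trans.
by rewrite lerDl F_ge0// running_max_ge1.
Qed.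

(** [I] stands for the tail integral. Three inequalities suffice: the first funds the start, the
    second makes [h] nonnegative, the third pays for each new maximum. *)
Lemma ensures_of_tail (c : R) (F I : R -> R) :
  I 1 <= 1 - c ->
  (forall m, 1 <= m -> F m / m <= I m) ->
  (forall m n, 1 <= m -> m <= n -> F m * (m^-1 - n^-1) <= I m - I n) ->
  exists Pi : strategy R, ensures Pi (fun Pi x =>
    forall t, c * price x t + F (running_max x t) <= capital Pi x t).
Proof.
move=> I1 FI Idiff.
pose h m := I m - F m / m.
have h_ge0 m : 1 <= m -> 0 <= h m by move=> m1; rewrite subr_ge0 FI.
exists (fun s => c + h (foldl Num.max 1 s)) => x x_ge0.
set Pi := fun _ => _.
have price_ge0 t : 0 <= price x t by case: t => /=.
have inv t : c * price x t + h (running_max x t) * price x t +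
    F (running_max x t) <= capital Pi x t.
  elim: t => [|t IH].
    have -> : running_max x 0 = 1.
      by rewrite running_maxE.
    (* Since [h 1 + F 1 = I 1], the invariant starts as [c + I 1 <= 1]. *)
    by rewrite /= /h; lra.
  have -> : capital Pi x t.+1 = capital Pi x t +
      (c + h (running_max x t)) * (x t - price x t).
    by rewrite running_maxE.
  have m1 := running_max_ge1 x t.
  have -> : running_max x t.+1 = Num.max (running_max x t) (x t).
    by rewrite !running_maxE mkseqS foldl_rcons.
  rewrite [price x t.+1]/=.
  set m := running_max x t in IH m1 *.
  (* Below the maximum both sides of the invariant change by the same amount. At a new maximum,
     replacing [m] by [x t] must not raise the required capital, which is [Idiff] multiplied by
     [x t]. *)
  case: (leP (x t) m) => [_|mx]; first lra.
  have xt0 : 0 < x t by lra.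
  have m0 : 0 < m by lra.
  suff : h (x t) * x t + F (x t) <= h m * x t + F m by lra.
  rewrite -subr_ge0.
  have -> : h m * x t + F m - (h (x t) * x t + F (x t)) =
      x t * (I m - I (x t) - F m * (m^-1 - (x t)^-1)).
    by rewrite /h; field; rewrite !gt_eqF.
  by rewrite mulr_ge0 ?subr_ge0 ?Idiff// ltW.
move=> t; apply: le_trans (inv t).
by rewrite -addrA lerD2l lerDr mulr_ge0// h_ge0// running_max_ge1.
Qed.

End Game.

(** * Riemann bounds and tails for the integral of [F y / y ^+ 2] *)

Section Integrals.
Context {R : realType}.
Notation mu := (@lebesgue_measure R).
Local Open Scope classical_set_scope.

Lemma measurable_inv_sqr (D : set R) : measurable D -> D `<=` `]0, +oo[ ->
  measurable_fun D (fun y : R => (y ^+ 2)^-1).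
Proof.
move=> mD D0; apply: (measurable_funS _ D0) => //.
apply: open_continuous_measurable_fun => //.
move=> y; rewrite inE/= in_itv/= andbT => y0.
apply: cvgV; first by rewrite expf_neq0// gt_eqF.
exact: exprn_continuous.
Qed.

Lemma integral_inv_sqr (a b : R) : 0 < a -> a <= b ->
  (\int[mu]_(y in `[a, b[) ((y ^+ 2)^-1)%:E = (a^-1 - b^-1)%:E)%E.
Proof.
move=> a0; rewrite le_eqVlt => /predU1P[<-|ab].
  by rewrite set_itvco0 integral_set0 subrr.
(* Half-open intervals keep grid cells disjoint; the endpoint is added for the fundamental theorem
   of calculus. *)
rewrite integral_itv_bndo_bndc; last first.
  apply/measurable_EFinP; apply: measurable_inv_sqr => //.
  by apply: subset_itv; rewrite bnd_simp.
have dV (x : R) : 0 < x -> is_derive x 1 (fun y : R => - y^-1) (x ^- 2).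
  move=> x0; have x_neq0 : id x != 0 by rewrite gt_eqF.
  have := is_deriveN (is_deriveV x_neq0 (is_derive_id x 1)).
  by rewrite scaleNr opprK [_ *: _]mulr1.
have cV (x : R) : 0 < x -> (fun y : R => - y^-1) y @[y --> x] --> - x^-1.
  by move=> x0; apply: cvgN; apply: cvgV => //; rewrite gt_eqF.
rewrite (@continuous_FTC2 _ _ (fun y : R => - y^-1))//.
- by rewrite -EFinB opprK addrC.
- apply: continuous_in_subspaceT => y.
  rewrite inE/= in_itv/= => /andP[ay _].
  apply: cvgV; first by rewrite expf_neq0// gt_eqF// (lt_le_trans a0).
  exact: exprn_continuous.
- split.
  + move=> y; rewrite in_itv/= => /andP[ay _].
    by have [] := dV y (lt_trans a0 ay).
  + exact/cvg_at_right_filter/cV.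
  + exact/cvg_at_left_filter/cV/(lt_trans a0).
- move=> y; rewrite in_itv/= => /andP[ay _].
  by rewrite derive1E; have [_ ->] := dV y (lt_trans a0 ay).
Qed.

Lemma integral_itvcy_grid (f : R -> \bar R) (b : nat -> R) :
  nondecreasing_seq b -> (forall y, exists n, y < b n) ->
  measurable_fun `[b 0%N, +oo[ f -> (forall y, b 0%N <= y -> (0 <= f y)%E) ->
  (\int[mu]_(y in `[b 0%N, +oo[) f y =
   \sum_(i <oo) \int[mu]_(y in `[b i, b i.+1[) f y)%E.
Proof.
move=> b_nd b_unbounded mf f_ge0.
have bE : `[b 0%N, +oo[ = \bigcup_i `[b i, b i.+1[.
  apply/seteqP; split => y /=; rewrite in_itv/=.
    (* The cell of [y] ends at the first grid point above [y]; that point is not [b 0] because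
       [b 0 <= y]. *)
    rewrite andbT => b0y; case: (ex_minnP (b_unbounded y)) => -[|n] yn min_n.
      by move: b0y; rewrite leNgt yn.
    exists n => //=; rewrite in_itv/= yn andbT leNgt.
    by apply/negP => /min_n; rewrite ltnn.
  move=> [n _ /=]; rewrite in_itv/= => /andP[bny _].
  by rewrite andbT (le_trans _ bny)// b_nd.
rewrite bE ge0_integral_bigcup//.
- by rewrite -bE.
- by move=> y; rewrite -bE /= in_itv/= andbT => /f_ge0.
- apply: ltn_trivIset => n m mn; apply/seteqP; split => // y [] /=.
  rewrite !in_itv/= => /andP[_ yb] /andP[by_ _].
  by move: (lt_le_trans yb (b_nd _ _ mn)); rewrite ltNge by_.
Qed.

Context (F : R -> R).
Hypothesis F_ge0 : forall y : R, 1 <= y -> 0 <= F y.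
Hypothesis F_incr : forall y z : R, 1 <= y -> y <= z -> F y <= F z.

Let G (y : R) : \bar R := (F y / y ^+ 2)%:E.

Lemma measurable_ratio (D : set R) : measurable D -> D `<=` `[1, +oo[ ->
  measurable_fun D G.
Proof.
move=> mD D1; apply: (measurable_funS _ D1) => //.
apply/measurable_EFinP; apply: measurable_funM; last first.
  by apply: measurable_inv_sqr => //; apply: subset_itvr; rewrite bnd_simp.
(* [F] is monotone only from 1 on; clamping its argument gives a function monotone on the whole line
   that agrees with [F] there. *)
have mF1 : measurable_fun (`[1, +oo[ : set R) (fun y : R => F (Num.max 1 y)).
  apply: nondecreasing_measurable => // y z yz.
  apply: F_incr; first by rewrite le_max lexx.
  by rewrite ge_max !le_max lexx yz orbT.
apply: eq_measurable_fun mF1 => y.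
by rewrite inE/= in_itv/= andbT => /max_r ->.
Qed.

Lemma ratio_ge0 (y : R) : 1 <= y -> (0 <= G y)%E.
Proof.
by move=> y1; rewrite lee_fin divr_ge0 ?F_ge0// exprn_ge0// (le_trans _ y1).
Qed.

Lemma integralZ_inv_sqr (k a b : R) : 0 <= k -> 0 < a -> a <= b ->
  (\int[mu]_(y in `[a, b[) (k / y ^+ 2)%:E = (k * (a^-1 - b^-1))%:E)%E.
Proof.
move=> k0 a0 ab; under eq_integral do rewrite EFinM.
rewrite ge0_integralZl_EFin ?integral_inv_sqr// => [y _|].
  by rewrite lee_fin invr_ge0 sqr_ge0.
apply/measurable_EFinP; apply: measurable_inv_sqr => //.
by apply: subset_itv; rewrite bnd_simp.
Qed.

Lemma measurable_cst_ratio (k a b : R) : 0 < a ->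
  measurable_fun `[a, b[ (fun y => (k / y ^+ 2)%:E).
Proof.
move=> a0; apply/measurable_EFinP; apply: measurable_funM => //.
by apply: measurable_inv_sqr => //; apply: subset_itv; rewrite bnd_simp.
Qed.

Lemma integral_ratio_ge (a b : R) : 1 <= a -> a <= b ->
  ((F a * (a^-1 - b^-1))%:E <= \int[mu]_(y in `[a, b[) G y)%E.
Proof.
move=> a1 ab; have a0 : 0 < a by exact: lt_le_trans a1.
rewrite -integralZ_inv_sqr// ?F_ge0//.
apply: ge0_le_integral => //.
- by move=> y _; rewrite lee_fin divr_ge0 ?F_ge0// sqr_ge0.
- exact: measurable_cst_ratio.
- by apply: measurable_ratio => //; apply: subset_itv; rewrite bnd_simp.
- move=> y /=; rewrite in_itv/= => /andP[ay _].
  by rewrite lee_fin ler_wpM2r ?invr_ge0 ?sqr_ge0// F_incr.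
Qed.

Lemma integral_ratio_le (a b : R) : 1 <= a -> a <= b ->
  (\int[mu]_(y in `[a, b[) G y <= (F b * (a^-1 - b^-1))%:E)%E.
Proof.
move=> a1 ab; have a0 : 0 < a by exact: lt_le_trans a1.
rewrite -integralZ_inv_sqr// ?F_ge0 ?(le_trans a1)//.
apply: ge0_le_integral => //.
- move=> y /=; rewrite in_itv/= => /andP[ay _].
  by rewrite ratio_ge0// (le_trans a1).
- by apply: measurable_ratio => //; apply: subset_itv; rewrite bnd_simp.
- exact: measurable_cst_ratio.
- move=> y /=; rewrite in_itv/= => /andP[ay yb].
  by rewrite lee_fin ler_wpM2r ?invr_ge0 ?sqr_ge0// F_incr ?(le_trans a1)// ltW.
Qed.

Lemma integral_ratio_split (a b : R) : 1 <= a -> a <= b ->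
  (\int[mu]_(y in `[a, +oo[) G y =
   \int[mu]_(y in `[a, b[) G y + \int[mu]_(y in `[b, +oo[) G y)%E.
Proof.
move=> a1 ab.
have abE : `[a, +oo[ = `[a, b[ `|` `[b, +oo[.
  by rewrite -itv_bndbnd_setU ?bnd_simp.
rewrite abE ge0_integral_setU//.
- rewrite -abE; apply: measurable_ratio => //.
  by apply: subset_itvr; rewrite bnd_simp.
- move=> y; rewrite -abE /= in_itv/= andbT => ay.
  by rewrite ratio_ge0// (le_trans a1).
- rewrite disj_set2E; apply/eqP/seteqP; split => // y [] /=.
  by rewrite !in_itv/= andbT => /andP[_ yb]; rewrite leNgt yb.
Qed.

(* With ratio [q] the upper Riemann sum is at most [q] times the lower one. *)
Lemma integral_le_of_lower_sums (C : R) :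
  (forall b : nat -> R, b 0 = 1 -> nondecreasing_seq b ->
    forall n, \sum_(i < n) F (b i) * ((b i)^-1 - (b i.+1)^-1) <= C) ->
  (\int[mu]_(y in `[1%R, +oo[) G y <= C%:E)%E.
Proof.
move=> sum_le; apply/lee_addgt0Pr => e e0.
have C0 : 0 <= C.
  by have := sum_le (fun=> 1) erefl (fun _ _ _ => lexx _) 0; rewrite big_ord0.
(* Chosen so that [q * C <= C + e]; the summand 1 keeps the denominator positive when [C = 0]. *)
pose q := 1 + e / (1 + C).
have q1 : 1 < q by rewrite ltrDl divr_gt0//; lra.
have q0 : 0 < q by lra.
pose b n := q ^+ n.
have b_ge1 n : 1 <= b n by rewrite exprn_ege1// ltW.
have b_gt0 n : 0 < b n by rewrite exprn_gt0.
have b_nd : nondecreasing_seq b by move=> n m nm; rewrite ler_weXn2l// ltW.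
have b_unbounded y : exists n, y < b n.
  have bern n : 1 + n%:R * (q - 1) <= b n.
    elim: n => [|n IH]; first by rewrite mul0r addr0.
    rewrite /b exprS -/(b n) -natr1.
    have n0 : 0 <= n%:R :> R by [].
    have : 0 <= n%:R * (q - 1) * (q - 1) by rewrite !mulr_ge0//; lra.
    have : q * (1 + n%:R * (q - 1)) <= q * b n by rewrite ler_pM2l.
    lra.
  have q10 : 0 < q - 1 by lra.
  exists (Num.bound `|y / (q - 1)|); apply: lt_le_trans (bern _).
  have := le_lt_trans (ler_norm _) (archi_boundP (normr_ge0 (y / (q - 1)))).
  rewrite ltr_pdivrMr// => ?; lra.
have b0 : b 0 = 1 by [].
rewrite -b0 integral_itvcy_grid//; last 2 first.
- exact: measurable_ratio.
- by move=> y; exact: ratio_ge0.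
apply: lime_le.
  apply: is_cvg_nneseries => i _ _; apply: integral_ge0 => y /=.
  by rewrite in_itv/= => /andP[biy _]; rewrite ratio_ge0// (le_trans _ biy).
apply: nearW => n.
apply: (@le_trans _ _ (q * C)%:E); last first.
  rewrite lee_fin /q mulrDl mul1r lerD2l mulrAC ler_pdivrMr; last lra.
  by rewrite ler_pM2l//; lra.
apply: (@le_trans _ _
    (\sum_(i < n) (F (b i.+1) * ((b i)^-1 - (b i.+1)^-1))%:E)%E).
  by rewrite big_mkord; apply: lee_sum => i _; rewrite integral_ratio_le ?b_nd.
rewrite sumEFin lee_fin.
apply: (@le_trans _ _
    (q * \sum_(i < n.+1) F (b i) * ((b i)^-1 - (b i.+1)^-1))); last first.
  by rewrite ler_pM2l// sum_le.
(* On the geometric grid each difference of inverses is [q] times the next one, so the upper sum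
   over [n] cells is [q] times the lower sum over [n.+1] cells minus its first, nonnegative term. *)
rewrite big_ord_recl mulrDr mulr_sumr.
rewrite [leLHS](_ : _ = \sum_(i < n)
    q * (F (b i.+1) * ((b i.+1)^-1 - (b i.+2)^-1))); last first.
  apply: eq_bigr => i _; rewrite /b !exprS.
  by field; rewrite !gt_eqF.
rewrite lerDr pmulr_rge0// mulr_ge0 ?F_ge0// subr_ge0.
by rewrite lef_pV2 ?posrE// b_nd.
Qed.

(** On the tail [F] is at least [F m], and [y ^- 2] integrates to [m^-1] there. This is what makes
    the bet [h] nonnegative. *)
Lemma le_tail_integral (m : R) : 1 <= m ->
  ((F m / m)%:E <= \int[mu]_(y in `[m, +oo[) G y)%E.
Proof.
move=> m1; apply/lee_addgt0Pr => e e0.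
have m0 : 0 < m by exact: lt_le_trans m1.
(* Truncating at [n] costs [F m / n], which is at most [e]. *)
pose n := Num.max m (F m / e).
have mn : m <= n by rewrite le_max lexx.
have n0 : 0 < n by exact: lt_le_trans mn.
apply: (@le_trans _ _ ((F m * (m^-1 - n^-1))%:E + e%:E)%E).
  rewrite -EFinD lee_fin mulrBr -addrA lerDl addrC subr_ge0.
  rewrite ler_pdivrMr// mulrC -ler_pdivrMr//.
  by rewrite le_max lexx orbT.
rewrite leeD2r// (integral_ratio_split m1 mn).
apply: le_trans (integral_ratio_ge m1 mn) _.
rewrite leeDl//; apply: integral_ge0 => y /=; rewrite in_itv/= andbT => ny.
by rewrite ratio_ge0// (le_trans m1)// (le_trans mn).
Qed.

End Integrals.

(** * The equivalence, assembled from both directions *)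

Theorem proposition3p1 (R : realType) (c : R) (F : R -> R)
    (c_ge0 : 0 <= c)
    (F_ge0 : forall y : R, 1 <= y -> 0 <= F y)
    (F_incr : forall y z : R, 1 <= y -> y <= z -> F y <= F z) :
  (exists Pi : strategy R,
     ensures Pi (fun Pi x =>
       forall t : nat,
         c * price x t + F (running_max x t) <= capital Pi x t))
  <->
  (\int[@lebesgue_measure R]_(y in `[1%R, +oo[) (F y / y ^+ 2)%:E
     <= (1 - c)%:E)%E.
Proof.
split=> [[Pi Pi_ok]|int_le].
  apply: integral_le_of_lower_sums => // b b0 b_nd n.
  exact: ensures_lower_sum_le Pi_ok b0 b_nd n.
pose J m := (\int[@lebesgue_measure R]_(y in `[m, +oo[) (F y / y ^+ 2)%:E)%E.
have G_ge0 m y : 1 <= m -> `[m, +oo[%classic y -> (0 <= (F y / y ^+ 2)%:E)%E.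
  by move=> m1 /=; rewrite in_itv/= andbT => /(le_trans m1); exact: ratio_ge0.
have J_ge0 m : 1 <= m -> (0 <= J m)%E.
  by move=> m1; apply: integral_ge0 => y; exact: G_ge0.
(* [fine] sends infinite values to 0, so finiteness of every tail is needed before [fine \o J] can
   serve as [I]; it follows from that of [J 1]. *)
have J_fin m : 1 <= m -> J m \is a fin_num.
  move=> m1; rewrite ge0_fin_numE ?J_ge0//.
  apply: (@le_lt_trans _ _ (J 1)); last exact: le_lt_trans int_le (ltry _).
  rewrite [leRHS](integral_ratio_split F_ge0 F_incr _ m1)// leeDr//.
  apply: integral_ge0 => y /=; rewrite in_itv/= => /andP[y1 _].
  exact: ratio_ge0.
apply: (@ensures_of_tail _ _ _ (fine \o J)) => //=.
- by rewrite -lee_fin fineK ?J_fin.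
- by move=> m m1; rewrite -lee_fin fineK ?J_fin// le_tail_integral.
- move=> m n m1 mn; have n1 := le_trans m1 mn.
  rewrite lerBrDr -lee_fin EFinD !fineK ?J_fin//.
  rewrite [leRHS](integral_ratio_split F_ge0 F_incr m1 mn).
  by rewrite leeD2r// integral_ratio_ge.
Qed.
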